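(* Let $R$ be a commutative ring and $n\in\mathbb N$. (a) Let $B$ be an $n$-twisted Weyl algebra over $R$ over the commutative $R$-algebra $A$, with generators $\partial_1,\ldots,\partial_n$. Then there exists a unique structure $(A,\underline\sigma,\underline D)$ of $n$-twisted differential $R$-algebra of Schwarz type such that for all $i=1,\ldots,n$, $$\forall x\in A,\quad \partial_i x = D_i(x)+\sigma_i(x)\partial_i \quad\text{in } B. \qquad ( * )$$ (b) Conversely, given an $n$-twisted differential $R$-algebra of Schwarz type $(A,\underline\sigma,\underline D)$, there exists, up to isomorphism, a unique $n$-twisted Weyl algebra $B$ over $R$ with generators $\partial_1,\ldots,\partial_n$ over $A$ satisfying $( * )$ for all $i=1,\ldots,n$.
   Context: All rings have a unit; an $R$-algebra is an $R$-module with an $R$-bilinear multiplication making it a ring. An $n$-twisted differential $R$-algebra $(A,\underline\sigma,\underline D)$ is a commutative $R$-algebra $A$ with $n$ pairwise commuting $R$-algebra endomorphisms $\sigma_1,\ldots,\sigma_n$ of $A$ and, for each $i$, a $\sigma_i$-derivation $D_i$ of $A$, i.e. an $R$-linear map $D_i:A\to A$ with $D_i(xy)=D_i(x)y+\sigma_i(x)D_i(y)$ for all $x,y\in A$. It is of Schwarz type if $D_i\circ D_j=D_j\circ D_i$ for all $i,j$, and $\sigma_i\circ D_j=D_j\circ\sigma_i$ whenever $i\ne j$. A filtered $R$-algebra indexed by $\mathbb N^n$ (with the componentwise order) is an $R$-algebra $B$ with $R$-submodules $\mathrm{Fil}^{\underline k}$ ($\underline k\in\mathbb N^n$) such that $\mathrm{Fil}^{\underline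 k}\subset\mathrm{Fil}^{\underline l}$ if $\underline k\le\underline l$, $B=\bigcup\mathrm{Fil}^{\underline k}$, $\mathrm{Fil}^{\underline k}\cdot\mathrm{Fil}^{\underline l}\subset\mathrm{Fil}^{\underline k+\underline l}$, and $1\in\mathrm{Fil}^{\underline 0}$. An $n$-twisted Weyl algebra over $R$ is a filtered $R$-algebra $B$ indexed by $\mathbb N^n$ for which there are a commutative $R$-algebra $A$ (identified with the subalgebra $\mathrm{Fil}^{\underline 0}$ of $B$) and a monoid morphism $\mathbb N^n\to B$, $\underline k\mapsto\partial^{\underline k}$, to the multiplicative monoid of $B$, i.e. pairwise commuting elements $\partial_1,\ldots,\partial_n\in B$ with $\partial^{\underline k}=\partial_1^{k_1}\cdots\partial_n^{k_n}$, inducing an isomorphism $\bigoplus_{\underline k\in\mathbb N^n}A\,\underline k\simeq B$ of filtered (left) $A$-modules. In other words, $B$ is a free left $A$-module on the $\partial^{\underline k}$ and $\mathrm{Fil}^{\underline k}=\bigoplus_{\underline l\le\underline k}A\partial^{\underline l}$. One calls $\partial_1,\ldots,\partial_n$ generators of $B$ over $A$. *)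

(* Defs.v *)
From HB Require Import structures.
From mathcomp Require Import all_boot all_algebra finmap.

Set Implicit Arguments.
Unset Strict Implicit.
Unset Printing Implicit Defensive.

Import GRing.Theory.
Local Open Scope ring_scope.

(* MathComp's algType and comAlgType only cover nontrivial rings; these two
   types of algebras also allow the zero ring.                                *)
Record pzAlgType (R : pzRingType) := PzAlgType {
  pzalg_ring : pzRingType;
  pzalg_lmodule : GRing.Zmodule_isLmodule R pzalg_ring;
  pzalg_scaleAl : forall (r : R) (x y : pzalg_ring),
    GRing.Zmodule_isLmodule.scale pzalg_lmodule r (x * y) =
    GRing.Zmodule_isLmodule.scale pzalg_lmodule r x * y;
  pzalg_scaleAr : forall (r : R) (x y : pzalg_ring),
    GRing.Zmodule_isLmodule.scale pzalg_lmodule r (x * y) =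
    x * GRing.Zmodule_isLmodule.scale pzalg_lmodule r y
}.

Definition pzalg_sort (R : pzRingType) (A : pzAlgType R) : Type :=
  pzalg_ring A.
Coercion pzalg_sort : pzAlgType >-> Sortclass.

HB.instance Definition _ (R : pzRingType) (A : pzAlgType R) :=
  GRing.PzRing.copy (pzalg_sort A) (pzalg_ring A).
HB.instance Definition _ (R : pzRingType) (A : pzAlgType R) :
  GRing.Zmodule_isLmodule R (pzalg_sort A) := pzalg_lmodule A.

Record comPzAlgType (R : pzRingType) := ComPzAlgType {
  compzalg_alg :> pzAlgType R;
  compzalg_mulC : commutative (@GRing.mul compzalg_alg)
}.

Definition alg_morphism (R : pzRingType) (A B : pzAlgType R) (f : A -> B) :=
  linear f /\ monoid_morphism f.

Record twisted_diff (R : comPzRingType) (n : nat) (A : comPzAlgType R) :=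
  TwistedDiff {
    td_sigma : 'I_n -> A -> A;
    td_deriv : 'I_n -> A -> A;
    td_sigma_morphism : forall i, alg_morphism (td_sigma i);
    td_sigma_comm : forall i j x,
      td_sigma i (td_sigma j x) = td_sigma j (td_sigma i x);
    td_deriv_linear : forall i, linear (td_deriv i);
    td_deriv_mul : forall i x y,
      td_deriv i (x * y) = td_deriv i x * y + td_sigma i x * td_deriv i y
  }.

Definition schwarz (R : comPzRingType) (n : nat) (A : comPzAlgType R)
    (T : twisted_diff n A) : Prop :=
  (forall i j x,
     td_deriv T i (td_deriv T j x) = td_deriv T j (td_deriv T i x)) /\
  (forall i j x, i != j ->
     td_sigma T i (td_deriv T j x) = td_deriv T j (td_sigma T i x)).

Notation multi n := {ffun 'I_n -> nat}.

Definition multi_le (n : nat) (k l : multi n) : bool :=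
  [forall i, (k i <= l i)%N].

Record filtered_algebra (R : comPzRingType) (n : nat) := FilteredAlgebra {
  fa_sort :> pzAlgType R;
  Fil : multi n -> fa_sort -> Prop;
  Fil_zero : forall k, Fil k 0;
  Fil_linear : forall k (r : R) x y,
    Fil k x -> Fil k y -> Fil k (r *: x + y);
  Fil_le : forall k l x, multi_le k l -> Fil k x -> Fil l x;
  Fil_exhaustive : forall x, exists k, Fil k x;
  Fil_mul : forall k l x y, Fil k x -> Fil l y -> Fil (k + l) (x * y);
  Fil_one : Fil 0 1
}.

Definition monomial (R : pzRingType) (n : nat) (B : pzAlgType R)
    (d : 'I_n -> B) (k : multi n) : B :=
  \prod_(i < n) d i ^+ k i.

(* The A-linear map from the direct sum of copies of A indexed by multi n
   (finitely supported functions) to B, where A acts on the left through f.   *)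
Definition lin_comb (R : pzRingType) (n : nat) (A B : pzAlgType R)
    (f : A -> B) (d : 'I_n -> B) (c : {fsfun multi n -> A with 0}) : B :=
  \sum_(k <- finsupp c) f (c k) * monomial d k.

(* The identification of A with Fil 0 is the embedding tw_coef.               *)
Record twisted_weyl (R : comPzRingType) (n : nat) (A : comPzAlgType R) :=
  TwistedWeyl {
    tw_alg :> filtered_algebra R n;
    tw_coef : A -> tw_alg;
    tw_gen : 'I_n -> tw_alg;
    tw_coef_morphism : alg_morphism tw_coef;
    tw_coef_inj : injective tw_coef;
    tw_coef_Fil0 : forall b, Fil 0 b <-> exists a, b = tw_coef a;
    tw_gen_comm : forall i j, tw_gen i * tw_gen j = tw_gen j * tw_gen i;
    tw_free : bijective (lin_comb tw_coef tw_gen);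
    tw_Fil : forall k b, Fil k b <->
      exists2 c : {fsfun multi n -> A with 0},
        (forall l, l \in finsupp c -> multi_le l k)
        & b = lin_comb tw_coef tw_gen c
  }.

Definition weyl_rule (R : comPzRingType) (n : nat) (A : comPzAlgType R)
    (B : twisted_weyl n A) (T : twisted_diff n A) : Prop :=
  forall (i : 'I_n) (x : A),
    tw_gen B i * tw_coef B x =
    tw_coef B (td_deriv T i x) + tw_coef B (td_sigma T i x) * tw_gen B i.

Definition weyl_isomorphic (R : comPzRingType) (n : nat) (A : comPzAlgType R)
    (B B' : twisted_weyl n A) : Prop :=
  exists phi : B -> B',
    [/\ alg_morphism phi, bijective phi,
        forall k b, Fil k b <-> Fil k (phi b),
        forall a, phi (tw_coef B a) = tw_coef B' a
      & forall i, phi (tw_gen B i) = tw_gen B' i].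

(* Main.v *)
Require Import Defs.
From HB Require Import structures.
From mathcomp Require Import all_boot all_algebra finmap.
From mathcomp Require Import boolp monalg.

(** Why the correspondence holds.

    In a twisted Weyl algebra B over A, multiplicativity of the filtration
    puts d_i x in the step of index e_i, that is, in A + A d_i
    ([gen_coef_exists]). Its two coordinates are the only possible values of
    D_i x and sigma_i x. Every axiom of a twisted differential algebra of
    Schwarz type is then read off by expanding one element of B in two ways
    and comparing coordinates on the basis: d_i (r x + y), d_i (x y) and d_i 1
    on 1, d_i ([coords_deg1]), and d_i d_j x = d_j d_i x on
    1, d_i, d_j, d_i d_j for distinct i and j ([coords_deg2]).

    Conversely, B has to be the free left A-module M on the multi-indices, and
    left multiplication by d_i has to be the operator
      [gen_op] i : a d^k |-> D_i(a) d^k + sigma_i(a) d^(e_i + k).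
    These operators satisfy the commutation rule with the scalars of A because
    D_i is a sigma_i-derivation ([gen_op_lscale]), and they commute with each
    other exactly because of the Schwarz conditions ([gen_op_comm]). Letting
    (sum_k a_k d^k) act on M as sum_k a_k d^k, with d^k the composite of the
    operators, defines the product m m'. It makes left multiplications by
    elements of A and by d_i commute with right multiplications
    ([weyl_mul_lscale], [weyl_mul_gen_op]); as every element of M is built from
    these, associativity follows ([weyl_mulA]), with no computation of
    structure constants.

    For any other B' satisfying the rule, the expansion map M -> B' in the
    basis of B' is bijective by freeness and multiplicative because gen_op
    becomes left multiplication by the generator of B' ([expand_gen_op]);
    it is the required isomorphism ([weyl_universal]). *)

Set Implicit Arguments.
Unset Strict Implicit.
Unset Printing Implicit Defensive.

Import GRing.Theory.
Local Open Scope fset_scope.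
Local Open Scope ring_scope.

(** * Multi-indices *)

Section MultiIndices.
Variable n : nat.
Implicit Types (i j : 'I_n) (k l : multi n).

Definition unit_multi i : multi n := [ffun j => (i == j) : nat].

Lemma unit_multiE i j : unit_multi i j = (i == j).
Proof. by rewrite ffunE. Qed.

Lemma multiDE k l i : (k + l) i = (k i + l i)%N.
Proof. by rewrite ffunE. Qed.

(** Statements about d^k are proved by adding one generator at a time; no order
    on the generators needs to be fixed. *)
Lemma multi_ind (P : multi n -> Prop) :
  P 0 -> (forall i k, P k -> P (unit_multi i + k)) -> forall k, P k.
Proof.
move=> P0 PS k; have [d] := ubnP (\sum_i k i)%N.
elim: d k => // d IHd k lt_k_d.
have [/forallP k0|/forallPn[i ki_neq0]] := boolP [forall i, k i == 0%N].
  suff -> : k = 0 by [].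
  by apply/ffunP=> i; rewrite ffunE; apply/eqP.
(* Remove one unit from a nonzero entry. *)
pose l : multi n := [ffun j => (k j - (i == j))%N].
have k_def : k = unit_multi i + l.
  apply/ffunP=> j; rewrite multiDE unit_multiE ffunE subnKC //.
  by have [<-|//] := eqVneq i j; rewrite lt0n.
rewrite k_def; apply/PS/IHd; move: lt_k_d; rewrite k_def.
under eq_bigr do rewrite multiDE.
rewrite big_split /= (bigD1 i) //= unit_multiE eqxx.
by rewrite ltnS; apply: leq_trans; rewrite -addnA ltnS leq_addl.
Qed.

Lemma multi_leP k l : reflect (forall i, (k i <= l i)%N) (multi_le k l).
Proof. exact: forallP. Qed.

Lemma multi_le_refl k : multi_le k k.
Proof. exact/multi_leP. Qed.

Lemma multi_le_trans : transitive (@multi_le n).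
Proof.
move=> l k m /multi_leP le_kl /multi_leP le_lm; apply/multi_leP=> i.
exact: leq_trans (le_kl i) (le_lm i).
Qed.

Lemma multi_le_add k k' l l' :
  multi_le k l -> multi_le k' l' -> multi_le (k + k') (l + l').
Proof.
move=> /multi_leP le_kl /multi_leP le_kl'; apply/multi_leP=> i.
by rewrite !multiDE leq_add.
Qed.

Lemma multi_le0 k : multi_le k 0 -> k = 0.
Proof.
move=> /multi_leP k_le0; apply/ffunP=> i; have := k_le0 i.
by rewrite ffunE leqn0 => /eqP.
Qed.

Lemma multi_le_unit k i :
  multi_le k (unit_multi i) -> k = 0 \/ k = unit_multi i.
Proof.
move=> /multi_leP le_k.
have k_off j : i != j -> k j = 0%N.
  move=> /negPf ij; move: (le_k j); rewrite unit_multiE ij leqn0.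
  by move/eqP.
have := le_k i; rewrite unit_multiE eqxx leq_eqVlt ltnS leqn0.
case/orP=> /eqP ki; [right|left]; apply/ffunP=> j; rewrite ffunE.
  by have [<- //|/k_off ->] := eqVneq i j.
by have [<- //|/k_off ->] := eqVneq i j.
Qed.

Lemma unit_multi_eq0 i : (unit_multi i == 0) = false.
Proof. by apply/eqP=> /ffunP/(_ i); rewrite !ffunE eqxx. Qed.

Lemma unit_multi_inj : injective unit_multi.
Proof.
move=> i j /ffunP/(_ i); rewrite !unit_multiE eqxx.
by case: eqP.
Qed.

End MultiIndices.

(** * Additive maps out of a free module *)

(** The additive map on the free module over K that extends the family F given
    on the summands. It is locked because comparing sums of finitely supported
    functions up to conversion is very costly. *)
HB.lock Definition malg_ext (K : choiceType) (G V : zmodType)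
    (F : K -> G -> V) (g : {malg G[K]}) : V :=
  \sum_(k <- msupp g) F k g@_k.

Section LinearExtension.
Variables (K : choiceType) (G V : zmodType).

(** Additive maps are compared, and additive properties proved, on single
    terms. *)
Lemma malg_ind (P : {malg G[K]} -> Prop) :
    P 0 -> (forall x y, P x -> P y -> P (x + y)) ->
  (forall k a, P << a *g k >>) -> forall g, P g.
Proof. by move=> P0 PD PU g; rewrite [g]monalgE; apply: big_ind. Qed.

Variable F : K -> G -> V.
Hypothesis F_additive : forall k, zmod_morphism (F k).

Let F0 k : F k 0 = 0.
Proof. by rewrite -[0 in LHS](subrr (0 : G)) F_additive subrr. Qed.

Let malg_ext_widen (E : {fset K}) g :
  msupp g `<=` E -> malg_ext F g = \sum_(k <- E) F k g@_k.
Proof.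
move=> supp_g; rewrite malg_ext.unlock.
by apply: big_fset_incl => // k _ /mcoeff_outdom ->; apply: F0.
Qed.

Lemma malg_ext_additive : zmod_morphism (malg_ext F).
Proof.
move=> x y; pose E := msupp x `|` msupp y.
rewrite (malg_ext_widen (msuppB_le x y)).
rewrite (malg_ext_widen (fsubsetUl (msupp x) (msupp y))).
rewrite (malg_ext_widen (fsubsetUr (msupp x) (msupp y))) -sumrB.
by apply: eq_bigr => k _; rewrite mcoeffB F_additive.
Qed.

Lemma malg_extU k a : malg_ext F << a *g k >> = F k a.
Proof. by rewrite (malg_ext_widen msuppU_le) big_seq_fset1 mcoeffUU. Qed.

End LinearExtension.

Section TermwiseEquality.
Variables (K : choiceType) (G : zmodType).
Implicit Types (k : K) (a b c d : G).

Lemma malg_eq2 k1 k2 a b a' b' : k1 != k2 ->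
    << a *g k1 >> + << b *g k2 >> = << a' *g k1 >> + << b' *g k2 >> ->
  a = a' /\ b = b'.
Proof.
move=> /negPf k12 eq_g; have coeffs k := congr1 (mcoeff k) eq_g.
have := coeffs k2; have := coeffs k1.
rewrite !mcoeffD !mcoeffU !eqxx (eq_sym k2) k12.
by rewrite !mulr0n !mulr1n !addr0 !add0r.
Qed.

Lemma malg_eq4 k1 k2 k3 k4 a b c d a' b' c' d' : uniq [:: k1; k2; k3; k4] ->
    << a *g k1 >> + << b *g k2 >> + << c *g k3 >> + << d *g k4 >> =
    << a' *g k1 >> + << b' *g k2 >> + << c' *g k3 >> + << d' *g k4 >> ->
  [/\ a = a', b = b', c = c' & d = d'].
Proof.
rewrite /= !inE !negb_or !andbT.
move=> /and3P[/and3P[k12 k13 k14] /andP[k23 k24] k34].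
move=> eq_g; have coeffs k := congr1 (mcoeff k) eq_g.
have := coeffs k4; have := coeffs k3; have := coeffs k2; have := coeffs k1.
rewrite !mcoeffD !mcoeffU !eqxx !(eq_sym k4).
rewrite !(eq_sym k3 k1, eq_sym k3 k2) (eq_sym k2 k1).
rewrite !(negPf k12, negPf k13, negPf k14, negPf k23, negPf k24, negPf k34).
by rewrite !mulr0n !mulr1n !addr0 !add0r.
Qed.

End TermwiseEquality.

(** * Algebras and their morphisms *)

Section AlgebraScaling.
Variables (R : pzRingType) (B : pzAlgType R).
Implicit Types (r : R) (x y : B).

Lemma alg_scalerAl r x y : r *: (x * y) = (r *: x) * y.
Proof. exact: pzalg_scaleAl. Qed.

Lemma alg_scalerAr r x y : r *: (x * y) = x * (r *: y).
Proof. exact: pzalg_scaleAr. Qed.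

End AlgebraScaling.

Section AlgMorphism.
Variables (R : pzRingType) (A B : pzAlgType R) (f : A -> B).
Hypothesis f_morph : alg_morphism f.

Lemma alg_morph_additive : zmod_morphism f.
Proof. exact: (zmod_morphism_linear f_morph.1). Qed.

Lemma alg_morphM x y : f (x * y) = f x * f y.
Proof. exact: f_morph.2.2. Qed.

Lemma alg_morph1 : f 1 = 1.
Proof. exact: f_morph.2.1. Qed.

Lemma alg_morphZ r x : f (r *: x) = r *: f x.
Proof. exact: (scalable_linear f_morph.1). Qed.

End AlgMorphism.

(** The case where the monomial begins with another generator than d i is the
    one that needs commutation: d i has to pass all the preceding powers. *)
Lemma monomialS (R : pzRingType) (n : nat) (B : pzAlgType R) (d : 'I_n -> B) :
    (forall i j, d i * d j = d j * d i) ->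
  forall i k, monomial d (unit_multi i + k) = d i * monomial d k.
Proof.
move=> d_comm i k; rewrite /monomial.
have comm_prod j (s : seq 'I_n) (e : 'I_n -> nat) :
    GRing.comm (d j) (\prod_(l <- s) d l ^+ e l).
  by apply: commr_prod => l _; apply/commrX/d_comm.
under eq_bigr do rewrite multiDE unit_multiE exprD.
have := index_enum_uniq 'I_n; have := mem_index_enum i.
elim: (index_enum _) => // j s IHs; rewrite inE !big_cons => /=.
move=> i_js /andP[j_s s_uniq]; have [ij|ij] := eqVneq i j.
  rewrite -ij expr1 !mulrA; congr (_ * _); apply: eq_big_seq => l l_s.
  suff /negPf-> : i != l by rewrite expr0 mul1r.
  by apply: contraNneq j_s => il; rewrite -ij il.
rewrite (negPf ij) /= in i_js; rewrite IHs // expr0 mul1r !mulrA.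
by rewrite (commrX _ (d_comm i j)).
Qed.

(** * The twisted Weyl algebra of a twisted differential algebra *)

Section TwistedDiff.
Variables (R : comPzRingType) (n : nat) (A : comPzAlgType R).
Variable T : twisted_diff n A.
Notation sigma := (td_sigma T).
Notation deriv := (td_deriv T).

Lemma sigma_additive i : zmod_morphism (sigma i).
Proof. exact: (alg_morph_additive (td_sigma_morphism T i)). Qed.

HB.instance Definition _ i := GRing.isZmodMorphism.Build A A
  (sigma i) (sigma_additive i).

Lemma deriv_additive i : zmod_morphism (deriv i).
Proof. exact: (zmod_morphism_linear (td_deriv_linear T i)). Qed.

HB.instance Definition _ i := GRing.isZmodMorphism.Build A A
  (deriv i) (deriv_additive i).

Lemma sigmaM i x y : sigma i (x * y) = sigma i x * sigma i y.
Proof. exact: (alg_morphM (td_sigma_morphism T i)). Qed.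

Lemma sigma1 i : sigma i 1 = 1.
Proof. exact: (alg_morph1 (td_sigma_morphism T i)). Qed.

Lemma sigmaZ i r x : sigma i (r *: x) = r *: sigma i x.
Proof. exact: (alg_morphZ (td_sigma_morphism T i)). Qed.

Lemma derivZ i r x : deriv i (r *: x) = r *: deriv i x.
Proof. exact: (scalable_linear (td_deriv_linear T i)). Qed.

(** As for an ordinary derivation: D(1) = D(1 * 1) = D(1) + D(1). *)
Lemma deriv1 i : deriv i 1 = 0.
Proof.
have := td_deriv_mul T i 1 1; rewrite sigma1 !mul1r !mulr1 => D1.
by apply: (addrI (deriv i 1)); rewrite -D1 addr0.
Qed.

Local Notation M := {malg A[multi n]}.

Definition lscale (a : A) : M -> M := malg_ext (fun k b => << a * b *g k >>).

Lemma lscale_additive a : zmod_morphism (lscale a).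
Proof. by apply: malg_ext_additive => k x y; rewrite mulrBr monalgUB. Qed.

HB.instance Definition _ a := GRing.isZmodMorphism.Build M M
  (lscale a) (lscale_additive a).

Lemma lscaleU a k b : lscale a << b *g k >> = << a * b *g k >>.
Proof. by apply: malg_extU => l x y; rewrite mulrBr monalgUB. Qed.

Lemma lscaleA a b m : lscale a (lscale b m) = lscale (a * b) m.
Proof.
elim/malg_ind: m => [|x y IHx IHy|k c]; first by rewrite !raddf0.
  by rewrite !raddfD /= IHx IHy.
by rewrite !lscaleU mulrA.
Qed.

Lemma lscale1 m : lscale 1 m = m.
Proof.
elim/malg_ind: m => [|x y IHx IHy|k c]; first by rewrite !raddf0.
  by rewrite !raddfD /= IHx IHy.
by rewrite lscaleU mul1r.
Qed.

Lemma lscaleDl a b m : lscale (a + b) m = lscale a m + lscale b m.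
Proof.
elim/malg_ind: m => [|x y IHx IHy|k c]; first by rewrite !raddf0 addr0.
  by rewrite !raddfD /= IHx IHy; apply: addrACA.
by rewrite !lscaleU mulrDl monalgUD.
Qed.

Lemma lscaleBl a b m : lscale (a - b) m = lscale a m - lscale b m.
Proof. by apply: (addIr (lscale b m)); rewrite -lscaleDl !subrK. Qed.

(** Left multiplication by the i-th generator, as the commutation rule forces
    it to act on the free module. *)
Definition gen_op (i : 'I_n) : M -> M := malg_ext (fun k a =>
  << deriv i a *g k >> + << sigma i a *g unit_multi i + k >>).

Let gen_op_term_additive i (k : multi n) : zmod_morphism (fun a : A =>
  << deriv i a *g k >> + << sigma i a *g unit_multi i + k >> : M).
Proof. by move=> x y; rewrite !raddfB addrACA -opprD. Qed.

Lemma gen_op_additive i : zmod_morphism (gen_op i).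
Proof. exact/malg_ext_additive/gen_op_term_additive. Qed.

HB.instance Definition _ i := GRing.isZmodMorphism.Build M M
  (gen_op i) (gen_op_additive i).

Lemma gen_opU i k a : gen_op i << a *g k >> =
  << deriv i a *g k >> + << sigma i a *g unit_multi i + k >>.
Proof. by rewrite /gen_op malg_extU. Qed.

(** The commutation rule between generators and scalars, as an identity of
    operators on M; this is the twisted Leibniz rule on coefficients. *)
Lemma gen_op_lscale i a m : gen_op i (lscale a m) =
  lscale (deriv i a) m + lscale (sigma i a) (gen_op i m).
Proof.
elim/malg_ind: m => [|x y IHx IHy|k b]; first by rewrite !raddf0 addr0.
  by rewrite !raddfD /= IHx IHy; apply: addrACA.
rewrite lscaleU !gen_opU raddfD /= !lscaleU td_deriv_mul sigmaM.
by rewrite monalgUD addrA.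
Qed.

(** gen_op is linear over the base ring: constants r * 1 are killed by D_i and
    fixed by sigma_i. *)
Lemma gen_op_scale i r m :
  gen_op i (lscale (r *: (1 : A)) m) = lscale (r *: (1 : A)) (gen_op i m).
Proof.
rewrite gen_op_lscale derivZ sigmaZ deriv1 sigma1 scaler0.
by rewrite -[0](subrr (0 : A)) lscaleBl subrr add0r.
Qed.

Definition monomial_op (k : multi n) (m : M) : M :=
  foldr (fun i => iter (k i) (gen_op i)) m (enum 'I_n).

Lemma monomial_op0 m : monomial_op 0 m = m.
Proof.
by rewrite /monomial_op; elim: (enum _) => //= i s ->; rewrite ffunE.
Qed.

Hypothesis T_schwarz : schwarz T.

(** Both composites have the coefficients D D, sigma D, D sigma and
    sigma sigma, in degrees k, e_i + k, e_j + k and e_i + e_j + k. The first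
    three agree under the Schwarz conditions, the last because the
    endomorphisms commute. *)
Lemma gen_op_comm i j m : gen_op i (gen_op j m) = gen_op j (gen_op i m).
Proof.
have [-> //|ij] := eqVneq i j.
elim/malg_ind: m => [|x y IHx IHy|k a]; first by rewrite !raddf0.
  by rewrite !raddfD /= IHx IHy.
have [D_comm sD_comm] := T_schwarz; have ji : j != i by rewrite eq_sym.
rewrite !gen_opU !raddfD /= !gen_opU.
rewrite (D_comm i j) (td_sigma_comm T i j) (sD_comm i j _ ij).
by rewrite -(sD_comm j i _ ji) (addrCA (unit_multi i)); apply: addrACA.
Qed.

Lemma monomial_opS i k m :
  monomial_op (unit_multi i + k) m = gen_op i (monomial_op k m).
Proof.
rewrite /monomial_op.
have := enum_uniq 'I_n; have := mem_enum 'I_n i; rewrite inE.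
have iter_comm j d x :
    gen_op i (iter d (gen_op j) x) = iter d (gen_op j) (gen_op i x).
  by elim: d => //= d <-; rewrite gen_op_comm.
elim: (enum _) => // j s IHs /=; rewrite inE multiDE unit_multiE.
move=> i_js /andP[j_s s_uniq]; have [ij|ij] := eqVneq i j.
  (* The index i does not recur in s, where both exponents agree. *)
  rewrite -ij iterD /=; congr (gen_op i (iter _ _ _)); rewrite ij in i_js *.
  elim: s j_s {IHs i_js s_uniq} => //= l s IHs; rewrite inE.
  move=> /norP[/negPf jl j_s].
  by rewrite IHs // multiDE unit_multiE jl.
by rewrite (negPf ij) /= in i_js; rewrite iter_comm IHs.
Qed.

Lemma monomial_op_additive k : zmod_morphism (monomial_op k).
Proof.
elim/multi_ind: k => [|i k IHk] x y; first by rewrite !monomial_op0.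
by rewrite !monomial_opS IHk raddfB.
Qed.

Lemma monomial_op_scale k r m :
  monomial_op k (lscale (r *: (1 : A)) m) =
  lscale (r *: (1 : A)) (monomial_op k m).
Proof.
elim/multi_ind: k => [|i k IHk]; first by rewrite !monomial_op0.
by rewrite !monomial_opS IHk gen_op_scale.
Qed.

Lemma monomial_op1 k : monomial_op k << 1 *g 0 >> = << 1 *g k >>.
Proof.
elim/multi_ind: k => [|i k IHk]; first by rewrite monomial_op0.
by rewrite monomial_opS IHk gen_opU deriv1 sigma1 monalgU0 add0r.
Qed.

(** A term a d^k of the left factor acts through the operator a d^k. *)
Definition weyl_mul (m m' : M) : M :=
  malg_ext (fun k a => lscale a (monomial_op k m')) m.

Let weyl_mul_term_additive m' k :
  zmod_morphism (fun a => lscale a (monomial_op k m')).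
Proof. by move=> a b; rewrite lscaleBl. Qed.

Lemma weyl_mulUl k a m : weyl_mul << a *g k >> m = lscale a (monomial_op k m).
Proof. by rewrite /weyl_mul malg_extU. Qed.

Let weyl_mul_additive m' : zmod_morphism (weyl_mul^~ m').
Proof. exact: malg_ext_additive. Qed.

Lemma weyl_mul0l m : weyl_mul 0 m = 0.
Proof. by rewrite -[0 in LHS](subrr (0 : M)) weyl_mul_additive subrr. Qed.

Lemma weyl_mulDl : left_distributive weyl_mul +%R.
Proof.
move=> x y m; rewrite -[x in RHS](addrK y).
by rewrite (weyl_mul_additive m (x + y) y) subrK.
Qed.

HB.instance Definition _ k := GRing.isZmodMorphism.Build M M
  (monomial_op k) (monomial_op_additive k).

Lemma weyl_mulDr : right_distributive weyl_mul +%R.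
Proof.
move=> m x y; elim/malg_ind: m => [|u v IHu IHv|k a].
- by rewrite !weyl_mul0l addr0.
- by rewrite !weyl_mulDl IHu IHv; apply: addrACA.
- by rewrite !weyl_mulUl !raddfD.
Qed.

Lemma weyl_mul_lscale a m m' :
  weyl_mul (lscale a m) m' = lscale a (weyl_mul m m').
Proof.
elim/malg_ind: m => [|u v IHu IHv|k b].
- by rewrite raddf0 !weyl_mul0l raddf0.
- by rewrite raddfD !weyl_mulDl IHu IHv raddfD.
- by rewrite lscaleU !weyl_mulUl lscaleA.
Qed.

Lemma weyl_mul_gen_op i m m' :
  weyl_mul (gen_op i m) m' = gen_op i (weyl_mul m m').
Proof.
elim/malg_ind: m => [|u v IHu IHv|k b].
- by rewrite raddf0 !weyl_mul0l raddf0.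
- by rewrite raddfD !weyl_mulDl IHu IHv raddfD.
- by rewrite gen_opU weyl_mulDl !weyl_mulUl monomial_opS gen_op_lscale.
Qed.

Lemma weyl_mul_monomial_op k m m' :
  weyl_mul (monomial_op k m) m' = monomial_op k (weyl_mul m m').
Proof.
elim/multi_ind: k => [|i k IHk]; first by rewrite !monomial_op0.
by rewrite !monomial_opS weyl_mul_gen_op IHk.
Qed.

(** By additivity the first factor can be taken to be a d^k, and then
    [weyl_mul_lscale] and [weyl_mul_monomial_op] move it out of the product. *)
Lemma weyl_mulA : associative weyl_mul.
Proof.
move=> m1 m2 m3; elim/malg_ind: m1 => [|u v IHu IHv|k a].
- by rewrite !weyl_mul0l.
- by rewrite !weyl_mulDl IHu IHv.
- by rewrite !weyl_mulUl weyl_mul_lscale weyl_mul_monomial_op.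
Qed.

Definition weyl_one : M := << 1 *g 0 >>.

Lemma weyl_mul1l : left_id weyl_one weyl_mul.
Proof. by move=> m; rewrite weyl_mulUl lscale1 monomial_op0. Qed.

Lemma weyl_mul1r : right_id weyl_one weyl_mul.
Proof.
elim/malg_ind=> [|u v IHu IHv|k a]; first by rewrite weyl_mul0l.
  by rewrite weyl_mulDl IHu IHv.
by rewrite weyl_mulUl monomial_op1 lscaleU mulr1.
Qed.

Lemma weyl_mul_scaler r m m' :
  weyl_mul m (lscale (r *: (1 : A)) m') = lscale (r *: (1 : A)) (weyl_mul m m').
Proof.
elim/malg_ind: m => [|u v IHu IHv|k a].
- by rewrite !weyl_mul0l raddf0.
- by rewrite !weyl_mulDl IHu IHv raddfD.
rewrite !weyl_mulUl monomial_op_scale !lscaleA; congr (lscale _ _).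
by rewrite -alg_scalerAr -alg_scalerAl mulr1 mul1r.
Qed.

(** Ring structures are packed on a named type and not declared canonical:
    the underlying free module does not determine T. *)
Definition weyl_ring : pzRingType :=
  HB.pack M (GRing.Zmodule_isPzRing.Build M
    weyl_mulA weyl_mul1l weyl_mul1r weyl_mulDl weyl_mulDr).

Let weyl_scale (r : R) : weyl_ring -> weyl_ring := lscale (r *: (1 : A)).

Let weyl_scaleA r s m : weyl_scale r (weyl_scale s m) = weyl_scale (r * s) m.
Proof. by rewrite /weyl_scale lscaleA -alg_scalerAl mul1r scalerA. Qed.

Let weyl_scale1 : left_id 1 weyl_scale.
Proof. by move=> m; rewrite /weyl_scale scale1r; apply: lscale1. Qed.

Let weyl_scaleDr : right_distributive weyl_scale +%R.
Proof. by move=> r x y; apply: raddfD. Qed.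

Let weyl_scaleDl m : {morph weyl_scale^~ m : r s / r + s}.
Proof. by move=> r s; rewrite /weyl_scale scalerDl; apply: lscaleDl. Qed.

Definition weyl_lmodule := GRing.Zmodule_isLmodule.Build R weyl_ring
  weyl_scaleA weyl_scale1 weyl_scaleDr weyl_scaleDl.

Definition weyl_pzalg : pzAlgType R := @PzAlgType R weyl_ring weyl_lmodule
  (fun r x y => esym (weyl_mul_lscale (r *: (1 : A)) x y))
  (fun r x y => esym (weyl_mul_scaler r x y)).

Lemma weyl_pzalgZ r (x : weyl_pzalg) : r *: x = lscale (r *: (1 : A)) x.
Proof. by []. Qed.

(** The filtration: all exponents that occur are bounded by k. *)
Definition degree_le (k : multi n) (m : M) :=
  forall l, l \in msupp m -> multi_le l k.

Lemma degree_le0 k : degree_le k 0.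
Proof. by move=> l; rewrite msupp0 inE. Qed.

Lemma degree_leU k l a : multi_le l k -> degree_le k << a *g l >>.
Proof. by move=> le_lk j /(fsubsetP msuppU_le); rewrite inE => /eqP ->. Qed.

Lemma degree_leD k x y : degree_le k x -> degree_le k y -> degree_le k (x + y).
Proof.
move=> x_le y_le l /(fsubsetP (msuppD_le x y)).
by rewrite inE => /orP[/x_le|/y_le].
Qed.

Lemma degree_le_trans k l m : multi_le k l -> degree_le k m -> degree_le l m.
Proof. by move=> le_kl m_le j /m_le /multi_le_trans; apply. Qed.

Lemma degree_le_exhaustive m : exists k, degree_le k m.
Proof.
exists [ffun i => \sum_(l <- msupp m) (l : multi n) i]%N => l l_m.
apply/multi_leP=> i; rewrite ffunE (big_fsetD1 l) //=; exact: leq_addr.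
Qed.

Lemma degree_le_ext k l (F : multi n -> A -> M) m :
    (forall j a, multi_le j k -> degree_le l (F j a)) ->
  degree_le k m -> degree_le l (malg_ext F m).
Proof.
move=> F_le m_le; rewrite malg_ext.unlock big_seq; apply: big_ind.
- exact: degree_le0.
- by move=> x y; apply: degree_leD.
- by move=> j /m_le; apply: F_le.
Qed.

Lemma degree_le_lscale k a m : degree_le k m -> degree_le k (lscale a m).
Proof. by apply: degree_le_ext => j b; apply: degree_leU. Qed.

Lemma degree_le_gen_op i k m :
  degree_le k m -> degree_le (unit_multi i + k) (gen_op i m).
Proof.
apply: degree_le_ext => j a le_jk; apply: degree_leD; apply: degree_leU.
  by rewrite -[j]add0r multi_le_add //; apply/multi_leP=> l; rewrite ffunE.
exact/multi_le_add/le_jk/multi_le_refl.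
Qed.

Lemma degree_le_monomial_op k l m :
  degree_le l m -> degree_le (k + l) (monomial_op k m).
Proof.
move=> m_le; elim/multi_ind: k => [|i k IHk].
  by rewrite monomial_op0 add0r.
by rewrite monomial_opS -addrA; apply: degree_le_gen_op.
Qed.

(** The product respects the filtration because D_i and sigma_i act on
    coefficients only, so that gen_op i maps the step k into the step
    e_i + k. *)
Lemma degree_leM k l x y :
  degree_le k x -> degree_le l y -> degree_le (k + l) (weyl_mul x y).
Proof.
move=> x_le y_le; apply: degree_le_ext x_le => j a le_jk.
apply/degree_le_lscale/degree_le_trans/degree_le_monomial_op/y_le.
exact/multi_le_add/multi_le_refl.
Qed.

Lemma degree_leZ k r (x y : weyl_pzalg) :
  degree_le k x -> degree_le k y -> degree_le k (r *: x + y).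
Proof. by move=> x_le; apply/degree_leD/degree_le_lscale. Qed.

Definition weyl_filtered : filtered_algebra R n :=
  @FilteredAlgebra R n weyl_pzalg degree_le degree_le0 degree_leZ
    degree_le_trans degree_le_exhaustive degree_leM
    (degree_leU (multi_le_refl 0)).

Definition weyl_coef (a : A) : weyl_filtered := << a *g 0 >>.
Definition weyl_gen (i : 'I_n) : weyl_filtered := << 1 *g unit_multi i >>.

Lemma weyl_coefM a (m : weyl_filtered) : weyl_coef a * m = lscale a m.
Proof. by rewrite [LHS]weyl_mulUl monomial_op0. Qed.

Lemma weyl_genM i (m : weyl_filtered) : weyl_gen i * m = gen_op i m.
Proof.
rewrite [LHS]weyl_mulUl lscale1 -[unit_multi i]addr0 monomial_opS.
by rewrite monomial_op0.
Qed.

Lemma weyl_coef_morphism : alg_morphism weyl_coef.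
Proof.
split=> [r x y|].
  have -> : r *: weyl_coef x = weyl_coef (r *: x).
    by rewrite weyl_pzalgZ lscaleU -alg_scalerAl mul1r.
  exact: monalgUD.
by split=> // x y; rewrite weyl_coefM /weyl_coef lscaleU.
Qed.

Lemma weyl_coef_inj : injective weyl_coef.
Proof. by move=> a b /(congr1 (mcoeff 0)); rewrite !mcoeffUU. Qed.

Lemma weyl_coef_Fil0 (b : weyl_filtered) :
  Fil 0 b <-> exists a, b = weyl_coef a.
Proof.
split=> [b_le|[a ->]]; last exact/degree_leU/multi_le_refl.
exists (mcoeff 0 b); apply/malgP=> k; rewrite mcoeffU.
have [<-|k_neq0] := eqVneq; first by [].
apply/eqP; rewrite mcoeff_eq0; apply/negP=> /b_le /multi_le0 k0.
by rewrite k0 eqxx in k_neq0.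
Qed.

Lemma weyl_gen_comm i j : weyl_gen i * weyl_gen j = weyl_gen j * weyl_gen i.
Proof.
have gen1 l : weyl_gen l = gen_op l weyl_one.
  by rewrite gen_opU deriv1 sigma1 monalgU0 add0r addr0.
by rewrite !weyl_genM !gen1 gen_op_comm.
Qed.

Lemma weyl_monomial k : monomial weyl_gen k = << 1 *g k >>.
Proof.
elim/multi_ind: k => [|i k IHk].
  by rewrite /monomial big1 // => i _; rewrite ffunE.
rewrite (monomialS weyl_gen_comm) IHk weyl_genM gen_opU deriv1 sigma1.
by rewrite monalgU0 add0r.
Qed.

Lemma weyl_lin_comb c : lin_comb weyl_coef weyl_gen c = mkmalg c.
Proof.
rewrite [RHS]monalgE; apply: eq_bigr => k _.
by rewrite weyl_monomial weyl_coefM lscaleU mulr1.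
Qed.

Lemma weyl_free : bijective (lin_comb weyl_coef weyl_gen).
Proof.
exists (@malg_val _ _ : weyl_filtered -> {fsfun multi n -> A with 0}).
  by move=> c; rewrite weyl_lin_comb.
by move=> m; rewrite weyl_lin_comb; case: m.
Qed.

Lemma weyl_Fil k (b : weyl_filtered) : Fil k b <->
  exists2 c : {fsfun multi n -> A with 0},
    (forall l, l \in finsupp c -> multi_le l k)
    & b = lin_comb weyl_coef weyl_gen c.
Proof.
split=> [b_le|[c c_le ->]]; last by rewrite weyl_lin_comb.
by exists (malg_val b) => //; rewrite weyl_lin_comb; case: b b_le.
Qed.

Definition weyl : twisted_weyl n A :=
  TwistedWeyl weyl_coef_morphism weyl_coef_inj weyl_coef_Fil0 weyl_gen_comm
    weyl_free weyl_Fil.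

Lemma weyl_weyl_rule : weyl_rule weyl T.
Proof.
move=> i x; rewrite [LHS]weyl_genM [in RHS]weyl_coefM lscaleU gen_opU.
by rewrite mulr1 addr0.
Qed.

End TwistedDiff.

(** * Coordinates in an arbitrary twisted Weyl algebra *)

Section Coordinates.
Variables (R : comPzRingType) (n : nat) (A : comPzAlgType R).
Variable B : twisted_weyl n A.
Notation coef := (tw_coef B).
Notation gen := (tw_gen B).
Local Notation M := {malg A[multi n]}.

HB.instance Definition _ := GRing.isZmodMorphism.Build A B
  coef (alg_morph_additive (tw_coef_morphism B)).

Lemma coefM x y : coef (x * y) = coef x * coef y.
Proof. exact: (alg_morphM (tw_coef_morphism B)). Qed.

Lemma coef1 : coef 1 = 1.
Proof. exact: (alg_morph1 (tw_coef_morphism B)). Qed.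

Lemma coefZ r x : coef (r *: x) = r *: coef x.
Proof. exact: (alg_morphZ (tw_coef_morphism B)). Qed.

(** The map lin_comb on the type {malg}, where it is an additive map. *)
Definition expand : M -> B :=
  malg_ext (fun k a => coef a * monomial gen k).

Let expand_term_additive k : zmod_morphism (fun a => coef a * monomial gen k).
Proof. by move=> a b; rewrite raddfB mulrBl. Qed.

Lemma expand_additive : zmod_morphism expand.
Proof. exact: malg_ext_additive. Qed.

HB.instance Definition _ := GRing.isZmodMorphism.Build M B
  expand expand_additive.

Lemma expandU k a : expand << a *g k >> = coef a * monomial gen k.
Proof. by rewrite /expand malg_extU. Qed.

Lemma expandE m : expand m = lin_comb coef gen (malg_val m).
Proof. by rewrite /expand malg_ext.unlock. Qed.

Lemma expand_bij : bijective expand.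
Proof.
have [coords lin_combK coordsK] := tw_free B.
exists (fun b => mkmalg (coords b)) => [m|b]; rewrite expandE.
  by rewrite lin_combK; case: m.
exact: coordsK.
Qed.

Lemma expand_lscale a m : expand (lscale a m) = coef a * expand m.
Proof.
elim/malg_ind: m => [|x y IHx IHy|k b]; first by rewrite !raddf0 mulr0.
  by rewrite !raddfD /= IHx IHy mulrDr.
by rewrite lscaleU !expandU coefM mulrA.
Qed.

(** The combination that witnesses the membership in the filtration step is
    the expansion itself, since expansions are unique. *)
Lemma expand_Fil k m : Fil k (expand m) <-> degree_le k m.
Proof.
rewrite tw_Fil; split=> [[c c_le]|m_le]; last first.
  by exists (malg_val m); rewrite ?expandE.
rewrite expandE => /(bij_inj (tw_free B)) m_c.
by move=> l l_m; apply: c_le; rewrite -m_c.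
Qed.

Lemma monomial0 : monomial gen 0 = 1.
Proof. by rewrite /monomial big1 // => i _; rewrite ffunE. Qed.

Lemma monomial_unit i : monomial gen (unit_multi i) = gen i.
Proof.
rewrite -[unit_multi i]addr0 (monomialS (@tw_gen_comm _ _ _ B)).
by rewrite monomial0 mulr1.
Qed.

Lemma expand0 a : expand << a *g 0 >> = coef a.
Proof. by rewrite expandU monomial0 mulr1. Qed.

Lemma expand_unit a i : expand << a *g unit_multi i >> = coef a * gen i.
Proof. by rewrite expandU monomial_unit. Qed.

Lemma expand_unit2 a i j :
  expand << a *g unit_multi i + unit_multi j >> = coef a * (gen i * gen j).
Proof. by rewrite expandU (monomialS (@tw_gen_comm _ _ _ B)) monomial_unit. Qed.

(** 1 and d_i are independent over A: the source of all the axioms that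
    involve one index. *)
Lemma coords_deg1 i a b a' b' :
    coef a + coef b * gen i = coef a' + coef b' * gen i -> a = a' /\ b = b'.
Proof.
rewrite -!expand_unit -!expand0 -2!raddfD => /(bij_inj expand_bij).
by apply: malg_eq2; rewrite eq_sym unit_multi_eq0.
Qed.

Section Morphism.
Variable T : twisted_diff n A.
Hypotheses (T_schwarz : schwarz T) (BT : weyl_rule B T).

(** This is where the commutation rule of B is used; multiplicativity of
    expand is a formal consequence. *)
Lemma expand_gen_op i m : expand (gen_op T i m) = gen i * expand m.
Proof.
elim/malg_ind: m => [|x y IHx IHy|k b]; first by rewrite !raddf0 mulr0.
  by rewrite !raddfD /= IHx IHy mulrDr.
rewrite gen_opU raddfD /= !expandU (monomialS (@tw_gen_comm _ _ _ B)) !mulrA.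
by rewrite BT mulrDl.
Qed.

Lemma expand_monomial_op k m :
  expand (monomial_op T k m) = monomial gen k * expand m.
Proof.
elim/multi_ind: k => [|i k IHk]; first by rewrite monomial_op0 monomial0 mul1r.
rewrite monomial_opS // expand_gen_op IHk (monomialS (@tw_gen_comm _ _ _ B)).
by rewrite mulrA.
Qed.

Lemma expandM m m' : expand (weyl_mul T m m') = expand m * expand m'.
Proof.
elim/malg_ind: m => [|x y IHx IHy|k a].
  by rewrite weyl_mul0l !raddf0 mul0r.
  by rewrite weyl_mulDl !raddfD /= IHx IHy mulrDl.
by rewrite weyl_mulUl expand_lscale expand_monomial_op expandU mulrA.
Qed.

Lemma weyl_universal : weyl_isomorphic (weyl T_schwarz) B.
Proof.
exists (expand : weyl T_schwarz -> B); split.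
- split=> [r x y|].
    rewrite raddfD [r *: x]weyl_pzalgZ /= expand_lscale coefZ coef1.
    by rewrite -alg_scalerAl mul1r.
  by split=> [|x y]; [rewrite [LHS]expand0 coef1 | apply: expandM].
- exact: expand_bij.
- by move=> k b; split=> /expand_Fil.
- exact: expand0.
- by move=> i; rewrite [LHS]expand_unit coef1 mul1r.
Qed.

End Morphism.

(** 1, d_i, d_j and d_i d_j are independent over A. Distinctness of i and j is
    essential: for i = j two of these elements coincide. *)
Lemma coords_deg2 i j a b c d a' b' c' d' : i != j ->
    coef a + coef b * gen i + coef c * gen j + coef d * (gen i * gen j) =
    coef a' + coef b' * gen i + coef c' * gen j + coef d' * (gen i * gen j) ->
  [/\ a = a', b = b', c = c' & d = d'].
Proof.
move=> ij; rewrite -!expand_unit2 -!expand_unit -!expand0 -6!raddfD.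
move=> /(bij_inj expand_bij); apply: malg_eq4.
have e0i : 0 != unit_multi i by rewrite eq_sym unit_multi_eq0.
have e0j : 0 != unit_multi j by rewrite eq_sym unit_multi_eq0.
have eij : unit_multi i != unit_multi j by rewrite (inj_eq (@unit_multi_inj n)).
rewrite /= !inE !negb_or e0i e0j eij /= andbT; apply/and3P; split.
- by apply/eqP=> /ffunP/(_ i); rewrite multiDE !unit_multiE eqxx ffunE.
- apply/eqP=> /ffunP/(_ j); rewrite multiDE !unit_multiE eqxx.
  by rewrite (negPf ij).
apply/eqP=> /ffunP/(_ i); rewrite multiDE !unit_multiE eqxx.
by rewrite eq_sym (negPf ij).
Qed.

(** The product d_i x lies in the filtration step e_i + 0, and the only
    multi-indices below e_i are 0 and e_i. The pair consists of the
    endomorphisms sigma and of the derivations D. *)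
Lemma gen_coef_exists : exists sD : ('I_n -> A -> A) * ('I_n -> A -> A),
  forall i x, gen i * coef x = coef (sD.2 i x) + coef (sD.1 i x) * gen i.
Proof.
have [coords expandK coordsK] := expand_bij.
exists (fun i x => mcoeff (unit_multi i) (coords (gen i * coef x)),
        fun i x => mcoeff 0 (coords (gen i * coef x))) => i x /=.
set m := coords _.
have m_le : degree_le (unit_multi i) m.
  apply/expand_Fil; rewrite coordsK -[unit_multi i]addr0.
  apply: Fil_mul; rewrite -1?expand0.
    rewrite -[gen i]mul1r -coef1 -expand_unit.
    exact/expand_Fil/degree_leU/multi_le_refl.
  exact/expand_Fil/degree_leU/multi_le_refl.
rewrite -(coordsK (gen i * coef x)) -/m -expand_unit -expand0 -raddfD.
congr (expand _); apply/malgP=> k; rewrite mcoeffD !mcoeffU.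
have [k_m|k_m] := boolP (k \in msupp m).
  have [->|->] := multi_le_unit (m_le k k_m).
    by rewrite eqxx unit_multi_eq0 addr0.
  by rewrite eqxx eq_sym unit_multi_eq0 add0r.
rewrite (mcoeff_outdom k_m).
have [k0|_] := eqVneq 0 k; last have [ki|_] := eqVneq (unit_multi i) k.
- by rewrite -k0 unit_multi_eq0 addr0 k0 (mcoeff_outdom k_m).
- by rewrite ki (mcoeff_outdom k_m) mulr0n addr0.
- by rewrite !mulr0n addr0.
Qed.

End Coordinates.

(** * The differential structure of a twisted Weyl algebra *)

Lemma twisted_diff_eq (R : comPzRingType) (n : nat) (A : comPzAlgType R)
    (T T' : twisted_diff n A) :
    (forall i, td_sigma T i =1 td_sigma T' i) ->
  (forall i, td_deriv T i =1 td_deriv T' i) -> T = T'.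
Proof.
case: T T' => [s D p1 p2 p3 p4] [s' D' p1' p2' p3' p4'] /= ss' DD'.
have {ss'} ss' : s = s' by apply/funext=> i; apply/funext/ss'.
have {DD'} DD' : D = D' by apply/funext=> i; apply/funext/DD'.
case: _ / ss' p1' p2' p4'; case: _ / DD' p3' => *.
by congr TwistedDiff; apply: Prop_irrelevance.
Qed.

(** Any pair of families that satisfies the commutation rule is a twisted
    differential structure of Schwarz type; no algebraic property of s and D
    is assumed. *)
Section Differential.
Variables (R : comPzRingType) (n : nat) (A : comPzAlgType R).
Variable B : twisted_weyl n A.
Notation coef := (tw_coef B).
Notation gen := (tw_gen B).
Variables s D : 'I_n -> A -> A.
Hypothesis rule : forall i x,
  gen i * coef x = coef (D i x) + coef (s i x) * gen i.

Let linear_Ds i r x y : D i (r *: x + y) = r *: D i x + D i y /\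
  s i (r *: x + y) = r *: s i x + s i y.
Proof.
apply: (@coords_deg1 _ _ _ B i); rewrite -rule !raddfD /= !coefZ mulrDr mulrDl.
by rewrite -alg_scalerAr -alg_scalerAl !rule scalerDr; apply: addrACA.
Qed.

Let mul_Ds i x y :
  D i (x * y) = D i x * y + s i x * D i y /\ s i (x * y) = s i x * s i y.
Proof.
apply: (@coords_deg1 _ _ _ B i).
rewrite -rule raddfD /= !coefM mulrA rule mulrDl.
by rewrite -[_ * gen i * _]mulrA rule mulrDr !mulrA addrA.
Qed.

Let s1 i : s i 1 = 1.
Proof.
apply: (proj2 (@coords_deg1 _ _ _ B i (D i 1) _ 0 _ _)).
by rewrite -rule coef1 mulr1 mul1r raddf0 add0r.
Qed.

(* Exchanging i and j leaves the left-hand side unchanged, so that the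
   coordinates on the right yield the commutation of s and D. *)
Let gen2_rule i j x : gen i * gen j * coef x =
  coef (D i (D j x)) + coef (s i (D j x)) * gen i +
  coef (D i (s j x)) * gen j + coef (s i (s j x)) * (gen i * gen j).
Proof.
by rewrite -mulrA rule mulrDr rule !mulrA rule mulrDl -!mulrA !addrA.
Qed.

Let comm_Ds i j x : i != j ->
  [/\ D i (D j x) = D j (D i x), s i (D j x) = D j (s i x)
    & s i (s j x) = s j (s i x)].
Proof.
move=> ij; suff [-> -> _ ->] :
  [/\ D i (D j x) = D j (D i x), s i (D j x) = D j (s i x),
      D i (s j x) = s j (D i x) & s i (s j x) = s j (s i x)] by [].
apply: (@coords_deg2 _ _ _ B i j) => //.
rewrite -gen2_rule (tw_gen_comm B) gen2_rule.
by congr (_ + _); apply: addrAC.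
Qed.

Let s_comm i j x : s i (s j x) = s j (s i x).
Proof. by have [-> //|/(@comm_Ds _ _ x)[]] := eqVneq i j. Qed.

Let s_morphism i : alg_morphism (s i).
Proof.
split=> [r x y|]; first by case: (linear_Ds i r x y).
by split=> [|x y]; [apply: s1 | case: (mul_Ds i x y)].
Qed.

Let D_linear i : linear (D i).
Proof. by move=> r x y; case: (linear_Ds i r x y). Qed.

Let D_mul i x y : D i (x * y) = D i x * y + s i x * D i y.
Proof. by case: (mul_Ds i x y). Qed.

Definition rule_diff : twisted_diff n A :=
  TwistedDiff s_morphism s_comm D_linear D_mul.

Lemma rule_diff_schwarz : schwarz rule_diff.
Proof.
split=> [i j x|i j x /(@comm_Ds _ _ x)[]//].
by have [-> //|/(@comm_Ds _ _ x)[]] := eqVneq i j.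
Qed.

End Differential.

Lemma weyl_rule_inj (R : comPzRingType) (n : nat) (A : comPzAlgType R)
    (B : twisted_weyl n A) (T T' : twisted_diff n A) :
  weyl_rule B T -> weyl_rule B T' -> T = T'.
Proof.
move=> ruleT ruleT'; have eq_Ds i x : td_deriv T i x = td_deriv T' i x /\
    td_sigma T i x = td_sigma T' i x.
  by apply: (@coords_deg1 _ _ _ B i); rewrite -ruleT -ruleT'.
by apply: twisted_diff_eq => i x; case: (eq_Ds i x).
Qed.

Theorem theorem5p3 (R : comPzRingType) (n : nat) (A : comPzAlgType R) :
  (forall B : twisted_weyl n A,
     exists! T : twisted_diff n A, schwarz T /\ weyl_rule B T) /\
  (forall T : twisted_diff n A, schwarz T ->
     exists B : twisted_weyl n A,
       weyl_rule B T /\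
       forall B' : twisted_weyl n A, weyl_rule B' T -> weyl_isomorphic B B').
Proof.
split=> [B|T T_schwarz].
  have [[s D] /= rule] := gen_coef_exists B.
  exists (rule_diff rule); split; first by split=> //; apply: rule_diff_schwarz.
  by move=> T [_ ruleT]; apply: weyl_rule_inj ruleT.
exists (weyl T_schwarz); split; first exact: weyl_weyl_rule.
by move=> B'; apply: weyl_universal.
Qed.
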